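(* For any constant $\epsilon>0$ the following holds w.h.p. (as $n\to\infty$): (a) $\chi_a\big(\mathcal{G}(n,p)\big)\le 2$ for $p=\frac{1-\epsilon}{n}$; (b) $\chi_a\big(\mathcal{G}(n,p)\big)>2$ for $p=\frac{1+\epsilon}{n}$.
   Context: For a finite simple graph $G=(V,E)$, the adaptable chromatic number $\chi_a(G)$ is the smallest $k$ such that for every (not necessarily proper) edge coloring $c:E\to\{1,\dots,k\}$ there exists a vertex coloring $\sigma:V\to\{1,\dots,k\}$ such that for every edge $uv\in E$ either $\sigma(u)\ne c(uv)$ or $\sigma(v)\neq c(uv)$. $\mathcal{G}(n,p)$ is the Erdős–Rényi random graph on $n$ labelled vertices in which each possible edge is included independently with probability $p$ (with $p\in[0,1]$). A sequence of events $A_n$ occurs w.h.p. if $\mathbb{P}[A_n]\to1$ as $n\to\infty$. *)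

(* Defs.v *)
From HB Require Import structures.
From mathcomp Require Import all_boot all_order all_algebra.
From mathcomp Require Import all_classical all_reals all_analysis.

Set Implicit Arguments.
Unset Strict Implicit.
Unset Printing Implicit Defensive.

Import Order.TTheory GRing.Theory Num.Theory.
Import numFieldNormedType.Exports.

Local Open Scope ring_scope.

(* The edges of a simple graph are two-element sets of vertices. *)
Record sgraph (V : finType) : Type := SGraph {
  edges : {set {set V}};
  edges_card2 : [forall e in edges, #|e| == 2%N] }.

HB.instance Definition _ (V : finType) := [isSub for @edges V].
HB.instance Definition _ (V : finType) := [Finite of sgraph V by <:].

Definition edge_of (V : finType) (G : sgraph V) : finType :=
  {e : {set V} | e \in edges G}.

Definition adaptably_colorable (V : finType) (G : sgraph V) (k : nat) : bool :=
  [forall c : {ffun edge_of G -> 'I_k}, exists sigma : {ffun V -> 'I_k},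
     [forall e : edge_of G, forall u : V, forall v : V,
        (val e == [set u; v]) ==> (sigma u != c e) || (sigma v != c e)]].

(* The palette {1, ..., k} is nonempty: for k = 0 a graph with an edge has no
   edge coloring at all and would be vacuously adaptably colorable. *)
Lemma ex_adaptably_colorable (V : finType) (G : sgraph V) :
  exists k : nat, (0 < k)%N && adaptably_colorable G k.
Proof.
exists #|V|.+1; rewrite /=; apply/forallP => c; apply/existsP.
exists [ffun v => widen_ord (leqnSn _) (enum_rank v)].
apply/forallP => e; apply/forallP => u; apply/forallP => v; apply/implyP.
move=> /eqP euv; rewrite -negb_and; apply/negP => /andP[/eqP cu /eqP cv].
have /enum_rank_inj uv : enum_rank u = enum_rank v.
  by apply: val_inj; move: cu; rewrite -cv !ffunE => /(congr1 val).
have /forallP /(_ (val e)) := edges_card2 G.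
by rewrite (valP e) euv uv finset.setUid cards1.
Qed.

Definition adaptable_chromatic_number (V : finType) (G : sgraph V) : nat :=
  ex_minn (ex_adaptably_colorable G).

(* The probability that G(n,p) equals G: each of the two-element subsets of
   'I_n is an edge independently with law [bernoulli_prob p].  Following the
   library, [bernoulli_prob p] is the Dirac measure at [false] when p is not in
   [0, 1], so that G(n,p) is then the empty graph. *)
Definition gnp_mass (R : realType) (n : nat) (p : R) (G : sgraph 'I_n) : R :=
  \prod_(e : {set 'I_n} | #|e| == 2%N)
    fine (bernoulli_prob p [set e \in edges G]%classic).

Definition gnp_prob (R : realType) (n : nat) (p : R)
    (A : pred (sgraph 'I_n)) : R :=
  \sum_(G : sgraph 'I_n | A G) gnp_mass p G.

(* The sequence of events "G(n, p n) satisfies A" occurs w.h.p. *)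
Definition gnp_whp (R : realType) (p : nat -> R)
    (A : forall n : nat, pred (sgraph 'I_n)) : Prop :=
  ((fun n : nat => gnp_prob (p n) (A n)) @ \oo --> (1 : R))%classic.

(* Main.v *)
(* (a) Call a path, together with two further distinct edges joining its two ends
   to vertices of the path, a bicycle; it has one more edge than it has vertices.
   A graph without bicycles is 2-adaptable: peel off leaves; when none remains, a
   longest path closes up to a cycle which is a whole component, and each vertex
   of it avoids the colour of the edge to its successor. For q = c / n with c < 1
   the expected number of bicycles is O(1/n).

   (b) Write G(n, (1+eps)/n) as the union of G(n, (1+eps/2)/n) and an independent
   G(n, q2) with q2 >= eps/(2n). The first graph has a path of linear length with
   probability 1 - O(1/n): following Krivelevich and Sudakov, run a depth-first
   search, whose number of positive answers is controlled by a second-moment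
   bound for an adaptive sequence of queries. With probability 1 - O(1/n) the
   second graph has a chord closing an odd cycle in each half of this path, and
   two odd cycles joined by a path force three colours. *)

Require Import Defs.
From mathcomp Require Import all_boot all_order all_algebra.
From mathcomp Require Import all_classical all_reals all_analysis.
From mathcomp Require Import zify ring lra.
From mathcomp Require Import fintype finset.

Set Implicit Arguments.
Unset Strict Implicit.
Unset Printing Implicit Defensive.

Import Order.TTheory GRing.Theory Num.Theory.
Import numFieldNormedType.Exports.

Local Open Scope ring_scope.

(** * Expectation over a random subset *)

(* The expectation of [f] at the random subset of [l] to which each element
   belongs independently with probability [q]. *)
Fixpoint Ex (R : realFieldType) (T : finType) (q : R) (l : seq T)
    (f : {set T} -> R) : R :=
  if l is e :: l' then
    q * Ex q l' (fun E => f (e |: E)) + (1 - q) * Ex q l' f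
  else f set0.

Lemma eq_Ex (R : realFieldType) (T : finType) (q : R) (l : seq T)
    (f g : {set T} -> R) :
  (forall E : {set T}, {subset E <= l} -> f E = g E) -> Ex q l f = Ex q l g.
Proof.
elim: l f g => [|e l IH] f g fg /=; first by apply: fg => x; rewrite in_set0.
congr (_ * _ + _ * _); apply: IH => E sE; apply: fg => x.
  by rewrite in_setU1 inE => /predU1P[->|/sE ->]; rewrite ?eqxx ?orbT.
by move/sE; rewrite inE => ->; rewrite orbT.
Qed.

Lemma le_Ex (R : realFieldType) (T : finType) (q : R) (l : seq T)
    (f g : {set T} -> R) :
  0 <= q <= 1 -> (forall E : {set T}, {subset E <= l} -> f E <= g E) ->
  Ex q l f <= Ex q l g.
Proof.
move=> /andP[q0 q1]; elim: l f g => [|e l IH] f g fg /=.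
  by apply: fg => x; rewrite in_set0.
apply: lerD; apply: ler_wpM2l; rewrite ?subr_ge0 //; apply: IH => E sE; apply: fg => x.
  by rewrite in_setU1 inE => /predU1P[->|/sE ->]; rewrite ?eqxx ?orbT.
by move/sE; rewrite inE => ->; rewrite orbT.
Qed.

Lemma Ex_cst (R : realFieldType) (T : finType) (q : R) (l : seq T) (a : R) :
  Ex q l (fun=> a) = a.
Proof. by elim: l => //= e l ->; ring. Qed.

Lemma ExD (R : realFieldType) (T : finType) (q : R) (l : seq T)
    (f g : {set T} -> R) : Ex q l (fun E => f E + g E) = Ex q l f + Ex q l g.
Proof. by elim: l f g => //= e l IH f g; rewrite !IH; ring. Qed.

Lemma ExZ (R : realFieldType) (T : finType) (q a : R) (l : seq T)
    (f : {set T} -> R) : Ex q l (fun E => a * f E) = a * Ex q l f.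
Proof. by elim: l f => //= e l IH f; rewrite !IH; ring. Qed.

Lemma Ex_sum (R : realFieldType) (T : finType) (q : R) (l : seq T)
    (I : Type) (r : seq I) (P : pred I) (F : I -> {set T} -> R) :
  Ex q l (fun E => \sum_(i <- r | P i) F i E) = \sum_(i <- r | P i) Ex q l (F i).
Proof.
elim: r => [|i r IH]; first by rewrite big_nil -[RHS](Ex_cst q l); apply: eq_Ex => E _; rewrite big_nil.
rewrite big_cons -IH; case: ifP => Pi.
  by rewrite -ExD; apply: eq_Ex => E _; rewrite big_cons Pi.
by apply: eq_Ex => E _; rewrite big_cons Pi.
Qed.

(** The draws for the entries of [l] are independent, so that of any [e] may be exposed first. *)
Lemma Ex_split (R : realFieldType) (T : finType) (q : R) (l : seq T) (e : T)
    (f : {set T} -> R) : e \in l ->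
  Ex q l f = q * Ex q (rem e l) (fun E => f (e |: E)) + (1 - q) * Ex q (rem e l) f.
Proof.
elim: l f => // a l IH f; rewrite inE /=; have [<- _|nae] := eqVneq a e; first by [].
move=> /= el; rewrite !(IH _ el) /=.
rewrite [Ex q _ (fun E => f (a |: (e |: E)))](eq_Ex _ (g := fun E => f (e |: (a |: E)))); last first.
  by move=> E _; rewrite setUCA.
ring.
Qed.

Lemma Ex_indep (R : realFieldType) (T : finType) (q : R) (l : seq T) (e : T)
    (f : {set T} -> R) : e \in l -> (forall E, f (e |: E) = f E) ->
  Ex q (rem e l) f = Ex q l f.
Proof.
move=> el fe; rewrite (Ex_split q f el) (eq_Ex _ (f := fun E => f (e |: E)) (g := f)) //.
ring.
Qed.

(** Conditioning on one element: used whenever a random variable branches on [e \in E] and neither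
    branch looks at [e] again. *)
Lemma Ex_if (R : realFieldType) (T : finType) (q : R) (l : seq T) (e : T)
    (f g : {set T} -> R) : uniq l -> e \in l ->
  (forall E, f (e |: E) = f E) -> (forall E, g (e |: E) = g E) ->
  Ex q l (fun E => if e \in E then f E else g E) = q * Ex q l f + (1 - q) * Ex q l g.
Proof.
move=> ul el fe ge; rewrite (Ex_split _ _ el); congr (_ * _ + _ * _).
  by rewrite -(Ex_indep q el fe); apply: eq_Ex => E _; rewrite setU11 fe.
rewrite -(Ex_indep q el ge); apply: eq_Ex => E sE; case: ifP => // /sE.
by rewrite mem_rem_uniq // inE eqxx.
Qed.

Lemma Ex_sub (R : realFieldType) (T : finType) (q : R) (l s : seq T) :
  uniq l -> uniq s -> {subset s <= l} ->
  Ex q l (fun E => (all [in E] s)%:R) = q ^+ size s.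
Proof.
move=> ul; elim: s => [|e s IH] /=; first by rewrite Ex_cst.
move=> /andP[es us] sl.
have el : e \in l by apply: sl; rewrite mem_head.
rewrite (eq_Ex _ (g := fun E => if e \in E then (all [in E] s)%:R else 0)); last first.
  by move=> E _; case: (e \in E).
rewrite Ex_if // ?Ex_cst ?IH // ?mulr0 ?addr0 ?exprS //.
  by move=> x xs; apply: sl; rewrite inE xs orbT.
move=> E; congr (nat_of_bool _)%:R; apply: eq_in_all => x xs /=.
by rewrite in_setU1; case: eqVneq => // xe; rewrite -xe xs in es.
Qed.

Lemma Ex_avoid (R : realFieldType) (T : finType) (q : R) (l s : seq T) :
  uniq l -> uniq s -> {subset s <= l} ->
  Ex q l (fun E => (~~ has [in E] s)%:R) = (1 - q) ^+ size s.
Proof.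
move=> ul; elim: s => [|e s IH] /=; first by rewrite Ex_cst.
move=> /andP[es us] sl.
have el : e \in l by apply: sl; rewrite mem_head.
rewrite (eq_Ex _ (g := fun E => if e \in E then 0 else (~~ has [in E] s)%:R)); last first.
  by move=> E _; case: (e \in E).
rewrite Ex_if // ?Ex_cst ?IH // ?mulr0 ?add0r ?exprS //.
  by move=> x xs; apply: sl; rewrite inE xs orbT.
move=> E; congr (nat_of_bool (~~ _))%:R; apply: eq_in_has => x xs /=.
by rewrite in_setU1; case: eqVneq => // xe; rewrite -xe xs in es.
Qed.

(** An element is missed by the union exactly when both independent rounds miss it. This is the
    two-round exposure behind sprinkling. *)
Lemma Ex_union (R : realFieldType) (T : finType) (q q1 q2 : R) (l : seq T)
    (f : {set T} -> R) : 1 - q = (1 - q1) * (1 - q2) ->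
  Ex q l f = Ex q1 l (fun E1 => Ex q2 l (fun E2 => f (E1 :|: E2))).
Proof.
move=> q12; have {q12} -> : q = q1 + q2 - q1 * q2 by move: q12; lra.
elim: l f => [|e l IH] f /=; first by rewrite setU0.
rewrite !IH !ExD !ExZ.
rewrite (eq_Ex q1 (l := l)
  (f := fun E1 => Ex q2 l (fun E2 => f (e |: E1 :|: (e |: E2))))
  (g := fun E1 => Ex q2 l (fun E2 => f (e |: (E1 :|: E2))))); last first.
  by move=> E1 _; apply: eq_Ex => E2 _; rewrite setUACA setUid.
rewrite [X in _ * (_ + _ * X) + _](eq_Ex _
  (g := fun E1 => Ex q2 l (fun E2 => f (e |: (E1 :|: E2))))); last first.
  by move=> E1 _; apply: eq_Ex => E2 _; rewrite setUA.
rewrite [X in _ + _ * (_ * X + _)](eq_Ex _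
  (g := fun E1 => Ex q2 l (fun E2 => f (e |: (E1 :|: E2))))); last first.
  by move=> E1 _; apply: eq_Ex => E2 _; rewrite setUCA.
ring.
Qed.

(** Ties the recursive expectation to explicit product weights as in [gnp_mass]; sets are split by
    whether they contain the head of [l]. *)
Lemma Ex_sumE (R : realFieldType) (T : finType) (q : R) (l : seq T)
    (f : {set T} -> R) : uniq l ->
  Ex q l f = \sum_(E : {set T} | E \subset l)
    (\prod_(e <- l) if e \in E then q else 1 - q) * f E.
Proof.
elim: l f => [|e l IH] f /=.
  rewrite (big_pred1 set0) ?big_nil ?mul1r // => E.
  apply/subsetP/eqP => [sE|-> x]; last by rewrite in_set0.
  by apply/setP => x; rewrite in_set0; apply/negP => /sE.
move=> /andP[el ul]; rewrite !IH // [RHS](bigID (fun E : {set T} => e \in E)) /=.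
congr (_ + _).
  rewrite [RHS](reindex_onto (fun E : {set T} => e |: E) (fun E : {set T} => E :\ e)) /=; last first.
    by move=> E /andP[_ eE]; rewrite setD1K.
  rewrite big_distrr /=; apply: eq_big => E.
    rewrite setU11 andbT; apply/idP/andP.
      move=> /subsetP sE; split.
        apply/subsetP => x; rewrite in_setU1 inE => /predU1P[->|/sE ->].
          by rewrite eqxx.
        by rewrite orbT.
      by rewrite setU1K //; apply/negP => /sE; rewrite (negPf el).
    move=> [/subsetP sE /eqP eE]; apply/subsetP => x xE.
    have: x \in e |: E by rewrite in_setU1 xE orbT.
    move/sE; rewrite inE; case: eqVneq => // xe.
    by move: xE; rewrite -eE !inE xe eqxx.
  move=> _; rewrite big_cons setU11 -mulrA; congr (_ * (_ * _)).
  apply: eq_big_seq => x xl; rewrite in_setU1; case: eqVneq => // xe.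
  by rewrite -xe xl in el.
rewrite big_distrr /=; apply: eq_big => E.
  apply/idP/andP.
    move=> /subsetP sE; split; last by apply/negP => /sE; rewrite (negPf el).
    by apply/subsetP => x /sE; rewrite inE orbC => ->.
  move=> [/subsetP sE eE]; apply/subsetP => x xE; move: (sE _ xE).
  by rewrite inE; case: eqVneq => // xe; rewrite -xe xE in eE.
move=> sE; rewrite big_cons ifN -?mulrA //.
by apply/negP => /(subsetP sE); rewrite (negPf el).
Qed.

(** * Graphs without bicycles *)

Definition path_edges (V : finType) (x : V) (s : seq V) : seq {set V} :=
  pairmap (fun a b => [set a; b]) x s.

Definition bicycle_edges (V : finType) (x : V) (s : seq V) (y z : V) :
    seq {set V} :=
  [set x; y] :: [set last x s; z] :: path_edges x s.

(** The edges are listed without repetition, so a bicycle on k + 1 vertices asks for k + 2 distinct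
    edges. A chord degenerating to a singleton is excluded once [E] consists of pairs. *)
Definition bicyclic (V : finType) (E : {set {set V}}) : Prop :=
  exists x s y z, [/\ uniq (x :: s), y \in x :: s, z \in x :: s,
    uniq (bicycle_edges x s y z) & {subset bicycle_edges x s y z <= E}].

Definition adj (V : finType) (E : {set {set V}}) : rel V :=
  fun a b => [set a; b] \in E.

(** Colours are [bool] and [c] is defined on all vertex sets, so that one and the same [c] serves
    for every subset of [E] in the inductions. *)
Definition two_adaptable (V : finType) (E : {set {set V}}) : Prop :=
  forall c : {set V} -> bool, exists sigma : V -> bool,
    forall u v, adj E u v ->
      (sigma u != c [set u; v]) || (sigma v != c [set u; v]).

Lemma adj_sym (V : finType) (E : {set {set V}}) : symmetric (adj E).
Proof. by move=> a b; rewrite /adj setUC. Qed.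

Lemma adj_neq (V : finType) (E : {set {set V}}) (a b : V) :
  {in E, forall e : {set V}, #|e| = 2%N} -> adj E a b -> a != b.
Proof. by move=> cE /cE; rewrite cards2; case: eqP. Qed.

Lemma path_adjE (V : finType) (E : {set {set V}}) (x : V) (s : seq V) :
  path (adj E) x s = all [in E] (path_edges x s).
Proof. by elim: s x => //= y s IH x; rewrite IH. Qed.

Lemma path_edges_sub (V : finType) (x : V) (s : seq V) (e : {set V}) :
  e \in path_edges x s -> {subset e <= x :: s}.
Proof.
elim: s x => //= y s IH x; rewrite inE => /predU1P[-> v|/IH sub v /sub vs].
  by rewrite !inE => /orP[] ->; rewrite ?orbT.
by rewrite inE vs orbT.
Qed.

(** The first vertex of a simple path lies on its first edge only. *)
Lemma path_edges_head (V : finType) (x : V) (s : seq V) (y : V) :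
  uniq (x :: s) -> y != x -> [set x; y] \in path_edges x s ->
  exists s', s = y :: s'.
Proof.
case: s => //= a s /and3P[xas _ _] yx; rewrite inE => /predU1P[xya|].
  have: y \in [set x; a] by rewrite -xya set22.
  by rewrite !inE (negPf yx) => /eqP <-; exists s.
by move/path_edges_sub => /(_ x (set21 _ _)); rewrite (negPf xas).
Qed.

Lemma path_edges_rcons (V : finType) (x : V) (s : seq V) (w : V) :
  path_edges x (rcons s w) = rcons (path_edges x s) [set last x s; w].
Proof. by rewrite /path_edges -cats1 pairmap_cat cats1. Qed.

Lemma path_edges_last (V : finType) (x : V) (s : seq V) (w z : V) :
  uniq (x :: rcons s w) -> z != w -> [set w; z] \in path_edges x (rcons s w) ->
  z = last x s.
Proof.
move=> us zw; rewrite path_edges_rcons mem_rcons inE => /predU1P[wz|].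
  have: z \in [set last x s; w] by rewrite -wz set22.
  by rewrite !inE (negPf zw) orbF => /eqP.
move/path_edges_sub => /(_ w (set21 _ _)).
by move: us; rewrite -rcons_cons rcons_uniq => /andP[/negPf ->].
Qed.

Lemma uniq_path_edges (V : finType) (x : V) (s : seq V) :
  uniq (x :: s) -> uniq (path_edges x s).
Proof.
elim: s x => //= y s IH x /andP[xs us]; rewrite IH // andbT.
by apply/negP => /path_edges_sub /(_ x (set21 _ _)); rewrite (negPf xs).
Qed.

Lemma ex_longest_path (V : finType) (e : rel V) (x0 y0 : V) :
  x0 != y0 -> e x0 y0 -> exists x s, [/\ (0 < size s)%N, uniq (x :: s), path e x s &
    forall x' s', uniq (x' :: s') -> path e x' s' -> (size s' <= size s)%N].
Proof.
move=> xy0 exy0.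
pose P k := `[< exists x s, [/\ size s = k, uniq (x :: s) & path e x s] >].
have exP : exists k, P k.
  by exists 1%N; apply/asboolP; exists x0, [:: y0]; rewrite /= inE xy0 exy0.
have ubP k : P k -> (k <= #|V|)%N.
  move=> /asboolP[x [s [<- us _]]]; apply: ltnW.
  by rewrite (leq_trans _ (max_card (mem (x :: s)))) // (card_uniqP us).
case: (ex_maxnP exP ubP) => k /asboolP[x [s [<- us ps]]] kmax.
exists x, s; split=> //; last first.
  by move=> x' s' us' ps'; apply: kmax; apply/asboolP; exists x', s'.
by apply: (kmax 1%N); apply/asboolP; exists x0, [:: y0]; rewrite /= inE xy0 exy0.
Qed.

(** The vertex [u] takes the colour that [[set u; v]] does not have; every other edge avoids [u] and
    keeps its colouring. *)
Lemma subset_two_adaptable_leaf (V : finType) (E : {set {set V}}) (u v : V) :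
  {in E, forall e : {set V}, #|e| = 2%N} ->
  (forall w, adj E u w -> w = v) ->
  two_adaptable (E :\ [set u; v]) -> two_adaptable E.
Proof.
move=> cE uE aE c; have [sigma sP] := aE c.
exists (fun w => if w == u then ~~ c [set u; v] else sigma w) => a b Eab.
have [au|au] := eqVneq a u.
  by move: Eab; rewrite au => /uE ->; case: (c _).
have [bu|bu] := eqVneq b u.
  by move: Eab; rewrite bu adj_sym => /uE ->; rewrite (setUC [set v]); apply/orP; right; case: (c _).
apply: sP; rewrite /adj in_setD1; apply/andP; split=> //.
apply/eqP => /setP /(_ u); rewrite set21 !inE.
by rewrite !(eq_sym u) (negPf au) (negPf bu).
Qed.

(** Every edge meeting [s] joins some vertex of [s] to its successor, and that vertex avoids the
    colour of the edge; the remaining edges are disjoint from [s]. *)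
Lemma subset_two_adaptable_cycle (V : finType) (E : {set {set V}}) (s : seq V) :
  uniq s -> (forall u v, u \in s -> adj E u v -> v = next s u \/ v = prev s u) ->
  two_adaptable [set e in E | [disjoint e & s]] -> two_adaptable E.
Proof.
move=> us nE aE c; have [sigma sP] := aE c.
exists (fun w => if w \in s then ~~ c [set w; next s w] else sigma w) => a b Eab.
have key u v : u \in s -> adj E u v -> v = next s u \/ u = next s v.
  move=> us1 /nE []// ->; first by left.
  by right; rewrite next_prev.
have [as_|as_] := boolP (a \in s).
  case: (key _ _ as_ Eab) => [->|ab]; first by case: (c _).
  have bs : b \in s by rewrite -(mem_next s) -ab.
  by rewrite bs (setUC [set a] [set b]) -ab; apply/orP; right; case: (c _).
have [bs|bs] := boolP (b \in s).
  move: Eab; rewrite adj_sym => Eba; case: (key _ _ bs Eba) => ab.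
    by rewrite ab mem_next bs in as_.
  by rewrite ab mem_next (negPf as_) in bs.
apply: sP; rewrite /adj inE [_ \in E]Eab /= disjoint_subset; apply/subsetP => x.
by rewrite !inE => /orP[] /eqP ->.
Qed.

Lemma bicyclicS (V : finType) (E E' : {set {set V}}) :
  E \subset E' -> bicyclic E -> bicyclic E'.
Proof.
move=> /subsetP sE [x [s [y [z [us ys zs ub sb]]]]].
by exists x, s, y, z; split=> // e /sb /sE.
Qed.

(* A longest path both of whose ends have degree at least two closes up, in the
   absence of a bicycle, to a cycle that is a whole connected component. *)
Lemma longest_path_cycle (V : finType) (E : {set {set V}}) (x : V) (s : seq V) :
  {in E, forall e : {set V}, #|e| = 2%N} -> ~ bicyclic E ->
  uniq (x :: s) -> path (adj E) x s ->
  (forall x' s', uniq (x' :: s') -> path (adj E) x' s' -> (size s' <= size s)%N) ->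
  (1 < size s)%N -> adj E (last x s) x ->
  forall u v, u \in x :: s -> adj E u v ->
    v = next (x :: s) u \/ v = prev (x :: s) u.
Proof.
move=> cE nb us ps smax s1 lx u v /[dup] us1 /rot_to [i s2 rs] uv.
(* The closed path is rotated so as to start at [u]; it is still a longest path. *)
have ur : uniq (u :: s2) by rewrite -rs rot_uniq.
have /andP[pu lu] : path (adj E) u s2 && adj E (last u s2) u.
  rewrite -rcons_path -[path _ _ _]/(cycle (adj E) (u :: s2)).
  by rewrite -rs rot_cycle /= rcons_path ps.
have sz : size s2 = size s.
  by apply: succn_inj; rewrite -[LHS]/(size (u :: s2)) -rs size_rot.
rewrite -(next_rot i us) -(prev_rot i us) rs.
(* Otherwise prepending [v] would give a longer path. *)
have vs : v \in u :: s2.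
  apply/negPn/negP => vs; have := smax v (u :: s2).
  by rewrite cons_uniq vs ur /= adj_sym uv pu sz ltnn; move/(_ isT isT).
have vu : v != u by rewrite eq_sym (adj_neq cE).
case: s2 => [|a s2] in rs ur pu lu sz vs *; first by move: s1; rewrite -sz.
have [->|va] := eqVneq v a; first by left; rewrite /= eqxx.
have [vl|vl] := eqVneq v (last a s2).
  right; rewrite vl; case/lastP: s2 {va vs vl uv} rs ur pu lu sz => [|s2 w] rs ur pu lu sz.
    by move: s1; rewrite -sz.
  rewrite last_rcons -[u :: a :: rcons s2 w]/(rcons (u :: a :: s2) w).
  by rewrite -(prev_rotr 1) ?rotr1_rcons //= ?eqxx // -rcons_cons -rcons_cons.
(* The two extra edges of the bicycle are the chord from [u] to [v] and the edge closing the
   cycle. *)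
exfalso; apply: nb; exists u, (a :: s2), v, u.
have al : a != last a s2.
  case/lastP: s2 {va vs vl uv} rs ur pu lu sz => [|s2 w] rs ur pu lu sz.
    by move: s1; rewrite -sz.
  rewrite last_rcons; move: ur => /= /and3P[_ + _].
  by rewrite mem_rcons inE negb_or => /andP[].
have lu' : last a s2 != u by rewrite (adj_neq cE).
split=> //; first by rewrite mem_head.
- rewrite /bicycle_edges [last _ _]/= cons_uniq (cons_uniq _ (path_edges _ _)).
  rewrite uniq_path_edges // andbT inE negb_or -andbA; apply/and3P; split.
  + apply/eqP => /setP /(_ v); rewrite set22 !inE (negPf vu) orbF => /esym.
    by rewrite (negPf vl).
  + apply/negP => /(path_edges_head ur vu) [s' [av _]].
    by rewrite av eqxx in va.
  + rewrite setUC; apply/negP => /(path_edges_head ur lu') [s' [av _]].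
    by rewrite -av eqxx in al.
- move=> e; rewrite !inE => /or3P[/eqP ->|/eqP ->|] //.
  by move: pu; rewrite path_adjE => /allP/(_ e).
Qed.

(** Strong induction on the number of edges: a leaf or an isolated cycle is removed and coloured
    last. If there is neither, the ends of a longest path yield a bicycle. *)
Lemma two_adaptable_of_not_bicyclic (V : finType) (E : {set {set V}}) :
  {in E, forall e : {set V}, #|e| = 2%N} -> ~ bicyclic E -> two_adaptable E.
Proof.
have [m] := ubnP #|E|; elim: m E => // m IH E; rewrite ltnS => Em cE nb.
have IH' (E' : {set {set V}}) : E' \proper E -> two_adaptable E'.
  move=> E'E; apply: IH; first by rewrite (leq_trans _ Em) ?proper_card.
    by move=> e /(subsetP (proper_sub E'E)) /cE.
  by move/(bicyclicS (proper_sub E'E)).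
have leaf u v : adj E u v -> (forall w, adj E u w -> w = v) -> two_adaptable E.
  move=> uv uE; apply: (subset_two_adaptable_leaf cE uE).
  by apply: IH'; rewrite properD1.
have [/existsP[x0 /existsP[y0 xy0]]|noe] := boolP [exists x0, exists y0, adj E x0 y0]; last first.
  move=> c; exists (fun=> true) => u v uv.
  by case/negP: noe; apply/existsP; exists u; apply/existsP; exists v.
have [x [s [s0 us ps smax]]] := ex_longest_path (adj_neq cE xy0) xy0.
(* By maximality the start of a longest path has all its neighbours on the path. *)
have ends x' s' : uniq (x' :: s') -> path (adj E) x' s' -> size s' = size s ->
    forall v, adj E x' v -> v \in x' :: s'.
  move=> us' ps' sz v x'v; apply/negPn/negP => vs.
  have := smax v (x' :: s'); rewrite cons_uniq vs us' /= adj_sym x'v ps' sz ltnn.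
  by move/(_ isT isT).
case: s => [|a s] // in s0 us ps smax ends *.
have [/existsP[y /andP[xy ya]]|xl] := boolP [exists y, adj E x y && (y != a)]; last first.
  apply: (leaf x a); first by case/andP: ps.
  move=> w xw; apply/eqP/negPn/negP => wa; case/negP: xl.
  by apply/existsP; exists w; rewrite xw.
have {s0} [t [w sE]] : exists t w, a :: s = rcons t w.
  by case/lastP: (a :: s) s0 => // t w _; exists t, w.
have wb : adj E w (last x t) by move: ps; rewrite sE rcons_path adj_sym => /andP[].
have [/existsP[z /andP[wz zb]]|wl] := boolP [exists z, adj E w z && (z != last x t)]; last first.
  apply: (leaf w (last x t)) => //.
  move=> z wz; apply/eqP/negPn/negP => zb; case/negP: wl.
  by apply/existsP; exists z; rewrite wz.
have ys : y \in x :: a :: s by apply: (ends).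
have zs : z \in x :: a :: s.
  (* Read backwards, the path starts at [w], so that [ends] applies to [w]. *)
  have rE : rev (x :: a :: s) = w :: rcons (rev t) x.
    by rewrite sE rev_cons rev_rcons.
  rewrite -mem_rev rE; apply: ends => //.
  - by rewrite -rE rev_uniq.
  - have := rev_path (adj E) x (a :: s); rewrite {1 2}sE last_rcons belast_rcons.
    rewrite rev_cons => ->; rewrite -(eq_path (e := adj E)) //.
    by move=> ? ?; rewrite adj_sym.
  - by rewrite sE !size_rcons size_rev.
have xy' : y != x by rewrite eq_sym (adj_neq cE).
have wz' : z != w by rewrite eq_sym (adj_neq cE).
have lw : last x (a :: s) = w by rewrite sE last_rcons.
(* If the extra edges at the two ends differ, they complete the path to a bicycle; if they coincide,
   this single edge closes the path to a cycle. *)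
have [xyE|xyn] := eqVneq [set x; y] [set w; z]; last first.
  case: nb; exists x, (a :: s), y, z; split=> //.
    rewrite /bicycle_edges cons_uniq (cons_uniq _ (path_edges _ _)) uniq_path_edges // andbT.
    rewrite lw inE negb_or xyn; apply/andP; split.
      by apply/negP => /(path_edges_head us xy')[s' [ya' _]]; rewrite ya' eqxx in ya.
    apply/negP; rewrite sE => /path_edges_last zb'.
    by rewrite zb' ?eqxx // in zb; rewrite -sE.
  move=> e; rewrite !inE => /or3P[/eqP ->|/eqP ->|] //.
    by rewrite lw.
  by move: ps; rewrite path_adjE => /allP/(_ e).
have xw : x != w.
  apply/eqP => xw; have := mem_last a s; rewrite -[last a s]/(last x (a :: s)) lw -xw => xs.
  by move: us; rewrite cons_uniq xs.
have zx : z = x.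
  by move/setP: xyE => /(_ x); rewrite set21 !inE (negPf xw) => /esym/eqP.
(* [z] is not the predecessor of [w], which would be [x] on a path with a single edge. *)
have s1 : (1 < size (a :: s))%N.
  rewrite /= ltnS lt0n; apply/eqP => /size0nil s0; move: sE zb; rewrite s0 zx.
  by case: (t) => [|? []] //= _; rewrite eqxx.
have lx : adj E (last x (a :: s)) x by rewrite lw -zx.
apply: (subset_two_adaptable_cycle us (longest_path_cycle cE nb us ps smax s1 lx)).
apply: IH'; apply/properP; split; first by apply/subsetP => e; rewrite inE => /andP[].
exists [set x; y] => //; rewrite inE negb_and; apply/orP; right.
by apply/negP => /disjointFr /(_ (set21 _ _)); rewrite mem_head.
Qed.

(** * Expected number of bicycles *)

Definition pairs (V : finType) : seq {set V} := enum [pred e : {set V} | #|e| == 2%N].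

Lemma mem_pairs (V : finType) (e : {set V}) : (e \in pairs V) = (#|e| == 2%N).
Proof. by rewrite mem_enum. Qed.

Lemma ler_sum_term (R : realFieldType) (I : finType) (F : I -> R) (i : I) (a : R) :
  (forall j, 0 <= F j) -> a <= F i -> a <= \sum_j F j.
Proof.
move=> F0 aF; apply: (le_trans aF).
by rewrite (bigD1 i) //= lerDl sumr_ge0.
Qed.

Definition tuple_bicycle (V : finType) (k : nat) (t : k.+1.-tuple V)
    (i j : 'I_k.+1) : seq {set V} :=
  bicycle_edges (thead t) (behead t) (tnth t i) (tnth t j).

(** Union bound over codes: the tuple of vertices and the positions of [y] and [z]. The test
    discards codes that repeat an edge or contain a loop, so that [Ex_sub] applies to the others. *)
Lemma bicyclic_le_sum (R : realFieldType) (V : finType) (E : {set {set V}}) :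
  {subset E <= pairs V} ->
  `[< bicyclic E >]%:R <=
  \sum_(k < #|V|) \sum_(t : k.+1.-tuple V) \sum_(i < k.+1) \sum_(j < k.+1)
    (if uniq (tuple_bicycle t i j) && all [in pairs V] (tuple_bicycle t i j)
     then (all [in E] (tuple_bicycle t i j))%:R else 0) :> R.
Proof.
move=> El; have F0 (k : nat) (t : k.+1.-tuple V) (i j : 'I_k.+1) :
    0 <= (if uniq (tuple_bicycle t i j) && all [in pairs V] (tuple_bicycle t i j)
     then (all [in E] (tuple_bicycle t i j))%:R else 0) :> R.
  by case: ifP.
have [[x [s [y [z [us ys zs ub sb]]]]]|_] := asboolP (bicyclic E); last first.
  by do 4![apply: sumr_ge0 => ? _].
have sV : (size s < #|V|)%N.
  by rewrite (leq_trans _ (max_card (mem (x :: s)))) // (card_uniqP us).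
have [iy iz] : (index y (x :: s) < (size s).+1)%N /\ (index z (x :: s) < (size s).+1)%N.
  by rewrite -[(size s).+1]/(size (x :: s)) !index_mem.
apply: (ler_sum_term (i := Ordinal sV)) => [k|]; first by do 3![apply: sumr_ge0 => ? _].
apply: (ler_sum_term (i := in_tuple (x :: s))) => [t|]; first by do 2![apply: sumr_ge0 => ? _].
apply: (ler_sum_term (i := Ordinal iy)) => [i|]; first by apply: sumr_ge0 => ? _.
apply: (ler_sum_term (i := Ordinal iz)) => [//|].
have -> : tuple_bicycle (in_tuple (x :: s)) (Ordinal iy) (Ordinal iz) = bicycle_edges x s y z.
  by rewrite /tuple_bicycle !(tnth_nth x) /= !nth_index.
have -> : all [in pairs V] (bicycle_edges x s y z) by apply/allP => e /sb /El.
by rewrite ub; have -> : all [in E] (bicycle_edges x s y z) by apply/allP.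
Qed.

(** First moment: on k + 1 vertices there are [#|V| ^ k.+1] tuples, [k.+1 ^ 2] choices of chord
    ends, and k + 2 edges to be present. *)
Lemma Ex_bicyclic (R : realFieldType) (V : finType) (q : R) : 0 <= q <= 1 ->
  Ex q (pairs V) (fun E => `[< bicyclic E >]%:R) <=
  \sum_(k < #|V|) #|V|%:R ^+ k.+1 * (k.+1%:R ^+ 2 * q ^+ k.+2).
Proof.
move=> /[dup] q01 /andP[q0 _].
apply: (le_trans (le_Ex q01 (@bicyclic_le_sum R V))).
rewrite Ex_sum; apply: ler_sum => k _; rewrite Ex_sum.
have -> : #|V|%:R ^+ k.+1 * (k.+1%:R ^+ 2 * q ^+ k.+2) =
    \sum_(t : k.+1.-tuple V) \sum_(i < k.+1) \sum_(j < k.+1) q ^+ k.+2.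
  by rewrite !sumr_const card_tuple card_ord -!mulrnA -[RHS]mulr_natl !natrM natrX; ring.
apply: ler_sum => t _; rewrite Ex_sum; apply: ler_sum => i _; rewrite Ex_sum.
apply: ler_sum => j _; case: (boolP (uniq _ && _)) => [/andP[ut /allP st]|_]; last first.
  by rewrite Ex_cst exprn_ge0.
by rewrite (Ex_sub q (enum_uniq _) ut st) /= size_pairmap size_behead size_tuple lexx.
Qed.

(** The whole series sums to (1 + c) / (1 - c)^3, whence the constant. *)
Lemma sum_sqr_geo (R : realFieldType) (c : R) (n : nat) : 0 <= c < 1 ->
  \sum_(k < n) k.+1%:R ^+ 2 * c ^+ k <= 2 / (1 - c) ^+ 3.
Proof.
move=> /andP[c0 c1]; pose y := (1 - c)^-1.
have y1 : 1 <= y by rewrite invf_ge1 ?subr_gt0 ?gerBl.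
have y0 : 0 <= y by lra.
have cy : c * y = y - 1 by rewrite /y; field; rewrite subr_eq0 gt_eqF.
(* [g k] is chosen to telescope: [g k - g k.+1 >= k.+1 ^+ 2 * c ^+ k]. *)
pose g (k : nat) := (k%:R ^+ 2 * y + 2 * k%:R * y ^+ 2 + 2 * y ^+ 3) * c ^+ k.
suff sg : \sum_(k < n) k.+1%:R ^+ 2 * c ^+ k <= g 0%N - g n.
  apply: (le_trans sg); rewrite -exprVn -/y /g expr0 mulr1 mulr0 !mul0r expr0n /=.
  by rewrite mul0r !add0r gerBl mulr_ge0 ?exprn_ge0 // !addr_ge0 ?mulr_ge0 ?exprn_ge0.
elim: n => [|n IH]; first by rewrite big_ord0 subrr.
rewrite big_ord_recr /=; apply: (le_trans (lerD IH (lexx _))).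
suff : n.+1%:R ^+ 2 * c ^+ n <= g n - g n.+1 by lra.
have -> : g n - g n.+1 = (n%:R ^+ 2 + 2 * n%:R + y + 1) * c ^+ n.
  rewrite /g (exprS c) -natr1.
  have c3 : c * y ^+ 3 = y ^+ 3 - y ^+ 2 by transitivity (c * y * y ^+ 2); [ring|rewrite cy; ring].
  have c2 : c * y ^+ 2 = y ^+ 2 - y by transitivity (c * y * y); [ring|rewrite cy; ring].
  by ring: cy c2 c3.
by rewrite ler_wpM2r ?exprn_ge0 // -natr1; nra.
Qed.

(** The surplus of one edge over the vertices leaves a factor [1 / #|V|] beside the powers of
    [q * #|V| <= c]. *)
Lemma Ex_bicyclic_le (R : realFieldType) (V : finType) (q c : R) :
  0 <= c < 1 -> 0 <= q <= c / #|V|%:R ->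
  Ex q (pairs V) (fun E => `[< bicyclic E >]%:R) <= 2 / (1 - c) ^+ 3 / #|V|%:R.
Proof.
move=> /[dup] c01 /andP[c0 c1] /andP[q0 qc].
(* For empty [V] the bound [c / 0] is 0, which forces [q = 0]. *)
have [V0|V0] := eqVneq #|V| 0%N.
  have q00 : q = 0 by apply/eqP; rewrite eq_le q0 andbT; move: qc; rewrite V0 invr0 mulr0.
  apply: (le_trans (Ex_bicyclic _ _)); first by rewrite q00 lexx ler01.
  by rewrite V0 big_ord0 invr0 mulr0.
have N0 : 0 < #|V|%:R :> R by rewrite ltr0n lt0n.
have N1 : 1 <= #|V|%:R :> R by rewrite ler1n lt0n.
have q1 : q <= 1.
  by apply: (le_trans qc); rewrite ler_pdivrMr // mul1r (le_trans (ltW c1)).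
apply: (le_trans (Ex_bicyclic _ _)); first by rewrite q0.
rewrite ler_pdivlMr //; apply: le_trans (sum_sqr_geo #|V| c01).
rewrite big_distrl /=; apply: ler_sum => k _.
have -> : #|V|%:R ^+ k.+1 * (k.+1%:R ^+ 2 * q ^+ k.+2) * #|V|%:R =
    k.+1%:R ^+ 2 * (q * #|V|%:R) ^+ k.+2 :> R.
  by rewrite exprMn !exprS; ring.
have qN : q * #|V|%:R <= c by rewrite -ler_pdivlMr.
have qN0 : 0 <= q * #|V|%:R by rewrite mulr_ge0 // ltW.
rewrite ler_wpM2l ?exprn_ge0 //; apply: (le_trans (lerXn2r _ _ _ qN)); rewrite ?nnegrE //.
by apply: ler_wiXn2l => //; [exact: ltW|rewrite ltnW].
Qed.

(** * Adaptive exploration *)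

Definition answer (T : finType) (E : {set T}) (oe : option T) : bool :=
  if oe is Some e then e \in E else false.

Fixpoint explore (T : finType) (St : Type) (query : St -> option T)
    (next : St -> bool -> St) (m : nat) (st : St) (E : {set T}) : St :=
  if m is m'.+1 then explore query next m' (next st (answer E (query st))) E
  else st.

(** Positive answers minus [q] per query: a martingale when queries are fresh. Steps without a query
    contribute 0. *)
Fixpoint score (R : realFieldType) (q : R) (T : finType) (St : Type)
    (query : St -> option T) (next : St -> bool -> St) (m : nat) (st : St)
    (E : {set T}) : R :=
  if m is m'.+1 then
    (if query st is Some e then (e \in E)%:R - q else 0) +
    score q query next m' (next st (answer E (query st))) E
  else 0.

(** No element is queried twice, so each answer is independent of the earlier ones. *)
Definition exploration (T : finType) (St : Type) (query : St -> option T)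
    (next : St -> bool -> St) (seen : St -> {set T}) : Prop :=
  (forall st e, query st = Some e -> e \notin seen st) /\
  (forall st b, seen (next st b) =
     if query st is Some e then e |: seen st else seen st).

Lemma score_indep (R : realFieldType) (q : R) (T : finType) (St : Type)
    (query : St -> option T) (next : St -> bool -> St) (seen : St -> {set T})
    (m : nat) (st : St) (e : T) (E : {set T}) :
  exploration query next seen -> e \in seen st ->
  score q query next m st (e |: E) = score q query next m st E.
Proof.
move=> [fresh seenE]; elim: m st => //= m IH st es.
have es' b : e \in seen (next st b).
  by rewrite seenE; case: (query st) => // e'; rewrite in_setU1 es orbT.
rewrite !IH //; case qe: (query st) => [e'|] //=.
have /negPf ee' : e' != e by apply: contraNneq (fresh _ _ qe) => ->.
by rewrite in_setU1 ee'.
Qed.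

(** The increments telescope, and freshness lets the queries be counted by the cardinal of
    [seen]. *)
Lemma score_card (R : realFieldType) (q : R) (T : finType) (St : Type)
    (query : St -> option T) (next : St -> bool -> St) (seen : St -> {set T})
    (m : nat) (st : St) (E : {set T}) :
  exploration query next seen ->
  score q query next m st E =
    (#|seen (explore query next m st E) :&: E|%:R
      - q * #|seen (explore query next m st E)|%:R)
    - (#|seen st :&: E|%:R - q * #|seen st|%:R).
Proof.
move=> [fresh seenE]; elim: m st => [|m IH] st /=; first by rewrite subrr.
rewrite IH seenE; case qe: (query st) => [e|]; last by rewrite add0r.
have es := fresh _ _ qe.
rewrite cardsU1 es /= setIUl; have [eE|eE] := boolP (e \in E).
  have -> : [set e] :&: E = [set e] by apply/setIidPl; rewrite sub1set.
  by rewrite cardsU1 inE (negPf es) /= !natrD; ring.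
have -> : [set e] :&: E = set0.
  by apply: disjoint_setI0; rewrite disjoints1.
by rewrite set0U /= !natrD; ring.
Qed.

(** Conditioned on the first answer, the continuation ignores the queried element and has mean 0, so
    the cross terms vanish. Each increment has variance at most q (1 - q) <= q. *)
Lemma Ex_score (R : realFieldType) (q : R) (T : finType) (St : Type)
    (query : St -> option T) (next : St -> bool -> St) (seen : St -> {set T})
    (l : seq T) (m : nat) (st : St) :
  0 <= q <= 1 -> uniq l -> (forall st e, query st = Some e -> e \in l) ->
  exploration query next seen ->
  Ex q l (score q query next m st) = 0 /\
  Ex q l (fun E => score q query next m st E ^+ 2) <= q * m%:R.
Proof.
move=> /andP[q0 q1] ul ql expl; elim: m st => [|m IH] st.
  by rewrite /= expr0n !Ex_cst mulr0.
rewrite /=; case qe: (query st) => [e|] /=; last first.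
  have [IH1 IH2] := IH (next st false); split.
    by rewrite -[RHS]IH1; apply: eq_Ex => E _; rewrite add0r.
  rewrite (eq_Ex _ (g := fun E => score q query next m (next st false) E ^+ 2)).
    by apply: (le_trans IH2); rewrite ler_wpM2l // ler_nat.
  by move=> E _; rewrite add0r.
have el := ql _ _ qe.
have ind b E : score q query next m (next st b) (e |: E) = score q query next m (next st b) E.
  by apply: (score_indep q _ _ expl); case: expl => _ ->; rewrite qe setU11.
have [t1 t2] := IH (next st true); have [f1 f2] := IH (next st false); split.
  rewrite (eq_Ex _ (g := fun E => if e \in E then
      (1 - q) + score q query next m (next st true) E
      else - q + score q query next m (next st false) E)); last first.
    by move=> E _; case: (e \in E); rewrite ?sub0r.
  rewrite Ex_if //; try by move=> E; rewrite ind.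
  by rewrite !ExD !Ex_cst t1 f1; ring.
rewrite (eq_Ex _ (g := fun E => if e \in E then
    ((1 - q) ^+ 2 + 2 * (1 - q) * score q query next m (next st true) E)
      + score q query next m (next st true) E ^+ 2
    else (q ^+ 2 + (- 2 * q) * score q query next m (next st false) E)
      + score q query next m (next st false) E ^+ 2)); last first.
  by move=> E _; case: (e \in E); rewrite /=; ring.
rewrite Ex_if //; try by move=> E; rewrite ind.
rewrite !ExD !Ex_cst !ExZ t1 f1 -natr1.
move: t2 f2; set a := Ex _ _ _; set b := Ex _ _ _ => t2 f2.
have : q * a <= q * (q * m%:R) by rewrite ler_wpM2l.
have : (1 - q) * b <= (1 - q) * (q * m%:R) by rewrite ler_wpM2l // subr_ge0.
have : 0 <= q ^+ 2 by rewrite exprn_ge0.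
rewrite expr2; nra.
Qed.

(** * Depth-first search *)

Record dfs (V : finType) := Dfs {
  finished : {set V}; stack : seq V; queried : {set {set V}} }.

(* Freezing at exactly [s0] finished vertices lets the count of queried pairs be
   read off at the final state, without tracking intermediate times. *)
Definition frozen (V : finType) (s0 u0 : nat) (st : dfs V) : bool :=
  (s0 <= #|finished st|)%N || (u0 <= size (stack st))%N.

Definition unexplored (V : finType) (st : dfs V) (u : V) : pred V :=
  [pred t | [&& t \notin finished st, t \notin stack st & [set u; t] \notin queried st]].

Definition dfs_query (V : finType) (s0 u0 : nat) (st : dfs V) : option {set V} :=
  if frozen s0 u0 st then None else
  if stack st is u :: _ then omap (fun t => [set u; t]) [pick t in unexplored st u]
  else None.

(** Apart from staying put, a step without a query either starts a new root on an empty stack or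
    moves the exhausted top of the stack to [finished]. *)
Definition dfs_next (V : finType) (s0 u0 : nat) (st : dfs V) (b : bool) : dfs V :=
  if frozen s0 u0 st then st else
  if stack st is u :: s then
    if [pick t in unexplored st u] is Some t then
      Dfs (finished st) (if b then t :: u :: s else u :: s) ([set u; t] |: queried st)
    else Dfs (u |: finished st) s (queried st)
  else if [pick t in ~: finished st] is Some t then
    Dfs (finished st) [:: t] (queried st)
  else st.

Definition dfs0 (V : finType) : dfs V := Dfs set0 [::] set0.

Lemma dfs_query_pairs (V : finType) (s0 u0 : nat) (st : dfs V) (e : {set V}) :
  dfs_query s0 u0 st = Some e -> e \in pairs V.
Proof.
rewrite /dfs_query; case: frozen => //; case: st => F [|u s] Q //=.
case: pickP => // t + [<-]; rewrite !inE /= ?inE => /and3P[_ /norP[tu _] _].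
by rewrite mem_pairs cards2 (eq_sym u) tu.
Qed.

Lemma dfs_exploration (V : finType) (s0 u0 : nat) :
  exploration (@dfs_query V s0 u0) (@dfs_next V s0 u0) (@queried V).
Proof.
rewrite /dfs_query /dfs_next; split=> [st e|st b]; case: frozen => //.
  by case: (stack st) => //= u s; case: pickP => // t; rewrite !inE => /and3P[_ _ tq] [<-].
by case: (stack st) => [|u s]; case: pickP.
Qed.

Definition has_path (V : finType) (k : nat) (E : {set {set V}}) : Prop :=
  exists x s, [/\ (k <= (size s).+1)%N, uniq (x :: s) & path (adj E) x s].

(** The stack is a path outside [finished], pairs from [finished] to untouched vertices have all
    been queried, and each positive answer pushes a vertex. In the last count of steps, a query or a
    new root adds at least 1 and a pop adds 2 - 1, hence the factor 2. *)
Definition dfs_invariant (V : finType) (s0 u0 : nat) (E : {set {set V}}) (m : nat)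
    (st : dfs V) : Prop :=
  [/\ [/\ uniq (stack st), {in stack st, forall u, u \notin finished st} &
        if stack st is u :: s then path (adj E) u s : Prop else True],
      (forall s t, s \in finished st -> t \notin finished st -> t \notin stack st ->
        [set s; t] \in queried st),
      (#|queried st :&: E| <= #|finished st| + size (stack st))%N,
      [/\ #|finished st| <= s0, size (stack st) <= u0 & #|queried st| <= m]%N &
      frozen s0 u0 st || (m <= #|queried st| + 2 * #|finished st| + size (stack st))%N].

Lemma dfs_invariant_next (V : finType) (s0 u0 : nat) (E : {set {set V}}) (m : nat)
    (st : dfs V) : (s0 <= #|V|)%N ->
  dfs_invariant s0 u0 E m st ->
  dfs_invariant s0 u0 E m.+1
    (dfs_next s0 u0 st (answer E (dfs_query s0 u0 st))).
Proof.
move=> s0V [[us ds ps] qST qE [fs0 su0 qm] step].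
rewrite /dfs_query /dfs_next.
have [fr|] := boolP (frozen s0 u0 st).
  by split=> //; [split=> //; apply: leqW|rewrite fr].
rewrite /frozen negb_or -!ltnNge => /andP[f_lt u_lt].
move: step; rewrite /frozen leqNgt f_lt leqNgt u_lt /= => step.
case: st us ds ps qST qE fs0 su0 qm f_lt u_lt step => F [|u s] Q /=.
  move=> us ds ps qST qE fs0 su0 qm f_lt u_lt step.
  case: pickP => [t|noF]; last first.
    (* A root is lacking only if all of [V] is finished, against [#|F| < s0 <= #|V|]. *)
    have : F = setT by apply/setP => t; move/negbT: (noF t); rewrite !inE negbK.
    by move=> FT; move: f_lt; rewrite FT cardsT ltnNge s0V.
  rewrite inE => tF; split=> //=.
  - by split=> // v; rewrite inE => /eqP ->.
  - by move=> a b aF bF _; apply: qST.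
  - by rewrite (leq_trans qE) ?leq_add2l.
  - by split=> //; apply: leqW.
  - by apply/orP; right; lia.
move=> us ds ps qST qE fs0 su0 qm f_lt u_lt step.
case: pickP => [t|noT] /=.
  rewrite inE /= => /and3P[tF ts tQ].
  have cQ : #|[set u; t] |: Q| = #|Q|.+1 by rewrite cardsU1 tQ.
  have cQE : (#|([set u; t] |: Q) :&: E| <= ([set u; t] \in E) + #|Q :&: E|)%N.
    rewrite setIUl; apply: (leq_trans (leq_card_setU _ _)); rewrite leq_add2r.
    have [eE|eE] := boolP (_ \in E).
      by rewrite (leq_trans (subset_leq_card (subsetIl _ _))) // cards1.
    by rewrite disjoint_setI0 ?cards0 // disjoints1.
  have [eE|/negPf eE] := boolP ([set u; t] \in E); rewrite eE in cQE; split=> //=.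
  - split=> //=; first by rewrite ts.
      move=> v; rewrite inE => /predU1P[->//|]; exact: ds.
    by rewrite adj_sym ps [adj _ _ _]eE.
  - move=> a b aF bF; rewrite inE negb_or => /andP[_ bs].
    by rewrite in_setU1 qST ?orbT.
  - by rewrite (leq_trans cQE) //= add1n addnS ltnS.
  - by rewrite cQ.
  - by apply/orP; right; rewrite cQ !addSn ltnS (leq_trans step) // leq_add2l.
  - by move=> a b aF bF bs; rewrite in_setU1 qST ?orbT.
  - exact: leq_trans cQE qE.
  - by rewrite cQ.
  - by apply/orP; right; rewrite cQ !addSn ltnS (leq_trans step) // leq_add2l.
(* Nothing is unexplored from [u]: its pairs with untouched vertices are all queried, so popping it
   keeps the invariant. *)
have uF : u \notin F by apply: ds; rewrite mem_head.
have cF : #|u |: F| = #|F|.+1 by rewrite cardsU1 uF.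
split=> //=.
- split; first by case/andP: us.
    move=> v vs; rewrite in_setU1 negb_or ds ?inE ?vs ?orbT // andbT.
    by apply: contraTneq vs => ->; case/andP: us.
  by case: s {us ds qST qE su0 u_lt step noT} ps => //= a s /andP[].
- move=> a b; rewrite !in_setU1 negb_or => /predU1P[->|aF] /andP[bu bF] bs.
    by move/negbT: (noT b); rewrite inE /= bF inE negb_or bu bs negbK.
  by apply: qST => //; rewrite inE negb_or bu bs.
- by rewrite cF; move: qE => /=; lia.
- by rewrite cF; split=> //; [apply: ltnW|apply: leqW].
- by apply/orP; right; rewrite cF; lia.
Qed.

Lemma dfs_invariant_explore (V : finType) (s0 u0 : nat) (E : {set {set V}})
    (m k : nat) (st : dfs V) : (s0 <= #|V|)%N ->
  dfs_invariant s0 u0 E k st ->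
  dfs_invariant s0 u0 E (k + m)
    (explore (dfs_query s0 u0) (dfs_next s0 u0) m st E).
Proof.
move=> s0V; elim: m k st => [|m IH] k st inv /=; first by rewrite addn0.
by rewrite -addSnnS; apply: IH; apply: dfs_invariant_next.
Qed.

(** Pairs of a finished and an untouched vertex embed into the queried sets, since only one end of
    such a set is finished. *)
Lemma leq_card_queried (V : finType) (st : dfs V) :
  (forall s t, s \in finished st -> t \notin finished st -> t \notin stack st ->
    [set s; t] \in queried st) ->
  (#|finished st| * (#|V| - (#|finished st| + size (stack st))) <= #|queried st|)%N.
Proof.
move=> qST; pose T := ~: (finished st :|: [set x in stack st]).
have cT : (#|V| - (#|finished st| + size (stack st)) <= #|T|)%N.
  rewrite leq_subLR -(cardsC (finished st :|: [set x in stack st])).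
  rewrite leq_add2r (leq_trans (leq_card_setU _ _)) // leq_add2l.
  by rewrite cardsE card_size.
apply: (leq_trans (leq_mul (leqnn _) cT)); rewrite -cardsX.
rewrite -(card_in_imset (f := fun p => [set p.1; p.2])).
  apply: subset_leq_card; apply/subsetP => _ /imsetP[[s t] + ->].
  by rewrite !inE /= negb_or => /and3P[sF tF ts]; apply: qST.
move=> [s t] [s' t']; rewrite !inE /= !negb_or => /and3P[sF tF ts] /and3P[sF' tF' ts'] eq.
have ss : s = s'.
  have : s \in [set s'; t'] by rewrite -eq set21.
  rewrite !inE => /orP[/eqP //|/eqP st']; by rewrite st' (negPf tF') in sF.
have tt : t = t'.
  have : t \in [set s'; t'] by rewrite -eq set22.
  rewrite !inE => /orP[/eqP ts0|/eqP //]; by rewrite ts0 sF' in tF.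
by rewrite ss tt.
Qed.

(** * Sprinkling on a long path *)

(** Without the path the stack stays below [u0], and [s0] finished vertices would require more than
    [m] queries. So the search never freezes: all but [2 * s0 + u0] of the steps are queries, with
    at most [s0 + u0] positive answers. *)
Lemma no_path_score (R : realFieldType) (V : finType) (q : R) (s0 u0 m : nat)
    (E : {set {set V}}) : 0 <= q -> (s0 <= #|V|)%N -> (0 < u0)%N ->
  (m < s0 * (#|V| - (s0 + u0)))%N -> ~ has_path u0 E ->
  q * (m%:R - (2 * s0 + u0)%:R) - (s0 + u0)%:R <=
    - score q (dfs_query s0 u0) (dfs_next s0 u0) m (dfs0 V) E.
Proof.
move=> q0 s0V u0_gt0 mlt noP; rewrite (score_card q m _ E (dfs_exploration V s0 u0)).
set st := explore _ _ _ _ _.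
have inv0 : dfs_invariant s0 u0 E 0 (dfs0 V).
  split=> //=; rewrite ?cards0 ?set0I ?cards0 ?orbT //.
  by move=> s t; rewrite inE.
have := dfs_invariant_explore m s0V inv0; rewrite add0n -/st.
case=> [[us ds ps] qST qE [fs0 su0 qm] step].
have su : (size (stack st) < u0)%N.
  rewrite ltnNge; apply/negP => le_u0; apply: noP.
  case: (stack st) us ps le_u0 => [_ _|u s us ps le_u0]; first by rewrite leqNgt u0_gt0.
  by exists u, s.
have fs : (#|finished st| < s0)%N.
  rewrite ltn_neqAle fs0 andbT; apply/eqP => fE.
  have := leq_trans (leq_card_queried qST) qm; rewrite fE leqNgt => /negP; apply.
  by rewrite (leq_trans mlt) // leq_mul2l leq_sub2l ?orbT // leq_add2l.
move: step; rewrite /frozen leqNgt fs leqNgt su /= => step.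
rewrite /= set0I !cards0 mulr0 !subr0 opprB.
apply: lerB.
  rewrite ler_wpM2l // lerBlDr -natrD ler_nat (leq_trans step) // -addnA leq_add2l.
  by rewrite leq_add ?leq_mul2l ?(ltnW fs) // ltnW.
by rewrite ler_nat (leq_trans qE) // leq_add ?(ltnW fs) // ltnW.
Qed.

(** Chebyshev's inequality for the score, which is far below its mean 0 when the path is missing. *)
Lemma Ex_no_path (R : realFieldType) (V : finType) (q : R) (s0 u0 m : nat) :
  0 <= q <= 1 -> (s0 <= #|V|)%N -> (0 < u0)%N ->
  (m < s0 * (#|V| - (s0 + u0)))%N ->
  0 < q * (m%:R - (2 * s0 + u0)%:R) - (s0 + u0)%:R ->
  Ex q (pairs V) (fun E => (~~ `[< has_path u0 E >])%:R) <=
    q * m%:R / (q * (m%:R - (2 * s0 + u0)%:R) - (s0 + u0)%:R) ^+ 2.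
Proof.
move=> /[dup] q01 /andP[q0 _] s0V u0_gt0 mlt lam0; set lam := _ - _ in lam0 *.
rewrite ler_pdivlMr ?exprn_gt0 // mulrC -ExZ.
have [_ sq] := Ex_score m (dfs0 V) q01 (enum_uniq _ : uniq (pairs V))
  (@dfs_query_pairs V s0 u0) (dfs_exploration V s0 u0).
apply: le_trans sq; apply: le_Ex => // E _.
case: asboolP => [_|noP]; first by rewrite mulr0 sqr_ge0.
rewrite mulr1 -[leRHS]sqrrN; have := no_path_score q0 s0V u0_gt0 mlt noP.
by rewrite -/lam => ?; rewrite lerXn2r ?nnegrE //; lra.
Qed.

(* Colour the t-th edge of the path by the parity of t: then "the t-th vertex
   is coloured by the parity of t" propagates forward along the path. The first
   chord forces it at position j, the second refutes it at position l. *)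
Lemma two_chords_not_two_adaptable (V : finType) (E : {set {set V}}) (x : V)
    (s : seq V) (i j k l : nat) :
  uniq (x :: s) -> path (adj E) x s ->
  (i.+1 < j <= k)%N -> (k.+1 < l < (size s).+1)%N ->
  odd i = odd j -> odd k = odd l ->
  adj E (nth x (x :: s) i) (nth x (x :: s) j) ->
  adj E (nth x (x :: s) k) (nth x (x :: s) l) ->
  ~ two_adaptable E.
Proof.
move=> us ps /andP[ij jk] /andP[kl ls] oij okl Eij Ekl.
set p := x :: s in us Eij Ekl.
have szp : size p = (size s).+1 by [].
pose e t := [set nth x p t; nth x p t.+1].
have nthI t t' : (t < size p)%N -> (t' < size p)%N -> nth x p t = nth x p t' -> t = t'.
  by move=> tp tp' /eqP; rewrite nth_uniq // => /eqP.
have nth_in a b c : (a < size p)%N -> (b < size p)%N -> (c < size p)%N ->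
    nth x p a \in [set nth x p b; nth x p c] -> a = b \/ a = c.
  move=> ap bp cp; rewrite !inE => /orP[] /eqP /nthI; [left|right]; auto.
have setI2 a b c d : (a < b < size p)%N -> (c < d < size p)%N ->
    [set nth x p a; nth x p b] = [set nth x p c; nth x p d] -> a = c /\ b = d.
  move=> /andP[ab bp] /andP[cd dp] eq.
  have ap := ltn_trans ab bp; have cp := ltn_trans cd dp.
  have := nth_in a c d ap cp dp; rewrite -eq set21 => /(_ isT).
  have := nth_in b c d bp cp dp; rewrite -eq set22 => /(_ isT).
  by lia.
pose c (f : {set V}) := if f == [set nth x p i; nth x p j] then ~~ odd i else
  if f == [set nth x p k; nth x p l] then odd k else
  [exists t : 'I_(size s), odd t && (f == e t)].
(* Neither chord is an edge of the path, because i + 1 < j and k + 1 < l, so the prescribed colours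
   do not clash. *)
have ce t : (t < size s)%N -> c (e t) = odd t.
  move=> ts; rewrite /c; case: eqP => [/setI2|_].
    by rewrite szp; lia.
  case: eqP => [/setI2|_]; first by rewrite szp; lia.
  apply/existsP/idP => [[t' /andP[ot' /eqP et]]|ot].
    have t's := ltn_ord t'.
    by have [-> _] : t = t' /\ t.+1 = t'.+1 by apply: setI2 et; rewrite szp ltnSn ltnS.
  by exists (Ordinal ts); rewrite ot eqxx.
have c1 : c [set nth x p i; nth x p j] = ~~ odd i by rewrite /c eqxx.
have c2 : c [set nth x p k; nth x p l] = odd k.
  rewrite /c eqxx; case: eqP => // /setI2; rewrite szp; lia.
move=> /(_ c)[sigma sP].
pose tau t := sigma (nth x p t) == odd t.
have tauS t : (t < size s)%N -> tau t -> tau t.+1.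
  move=> ts /eqP tt; have := sP _ _ (pathP x ps t ts).
  rewrite -[nth x s t]/(nth x p t.+1) -/(e t) (ce _ ts) tt eqxx /= /tau /=.
  by case: (sigma _); case: (odd t).
have tau_le t t' : (t <= t')%N -> (t' <= size s)%N -> tau t -> tau t'.
  move=> tt'; rewrite -(subnKC tt'); elim: (t' - t)%N => [|d IH]; first by rewrite addn0.
  by rewrite addnS => dt tt; apply: tauS => //; apply: IH => //; apply: ltnW.
have ks : (k <= size s)%N by apply: leq_trans (ltnW (ltnW kl)) _.
have js := leq_trans jk ks.
(* The first chord has colour [~~ odd i], so one of its ends is coloured [odd i = odd j]: either
   position i, whence j by propagation, or j itself. *)
have tauj : tau j.
  have := sP _ _ Eij; rewrite c1 => /orP[si|sj].
    by apply: (tau_le i); [exact: ltnW (ltnW ij)|exact: js|rewrite /tau; case: (sigma _) si; case: (odd i)].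
  by rewrite /tau -oij; case: (sigma _) sj; case: (odd i).
have tauk : tau k by apply: (tau_le j).
have taul : tau l by apply: (tau_le k) => //; apply: ltnW (ltnW kl).
have := sP _ _ Ekl; rewrite c2 (eqP tauk) eqxx /= => /negP; apply.
by rewrite okl.
Qed.

(** The ends are an even distance apart along the path, so each chord closes an odd cycle; a < m <=
    b yields m^2 different pairs. *)
Definition chords (V : finType) (x : V) (p : seq V) (d m : nat) : seq {set V} :=
  [seq [set nth x p (d + 2 * a); nth x p (d + 2 * b)] | a <- iota 0 m, b <- iota m m].

Lemma chordsP (V : finType) (x : V) (p : seq V) (d m : nat) (E : {set {set V}}) :
  reflect (exists a b, [/\ (a < m)%N, (m <= b < m + m)%N &
            adj E (nth x p (d + 2 * a)) (nth x p (d + 2 * b))])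
          (has [in E] (chords x p d m)).
Proof.
apply: (iffP hasP) => [[e /allpairsP[[a b] /=]]|[a [b [am bm ab]]]].
  by rewrite !mem_iota => -[am bm ->] eE; exists a, b.
by exists [set nth x p (d + 2 * a); nth x p (d + 2 * b)] => //; apply/allpairsP;
   exists (a, b); rewrite !mem_iota.
Qed.

Lemma Ex_no_chord (R : realFieldType) (V : finType) (q : R) (x : V) (p : seq V)
    (d m : nat) : uniq p -> (d + 4 * m <= size p)%N ->
  Ex q (pairs V) (fun E => (~~ has [in E] (chords x p d m))%:R) = (1 - q) ^+ (m * m).
Proof.
move=> us dm.
have nthI t t' : (t < size p)%N -> (t' < size p)%N -> nth x p t = nth x p t' -> t = t'.
  by move=> tp tp' /eqP; rewrite nth_uniq // => /eqP.
rewrite Ex_avoid ?enum_uniq //; first by rewrite size_allpairs !size_iota.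
  apply: allpairs_uniq; rewrite ?iota_uniq // => ab ab'.
  move=> /allpairsP[[a b] /= [+ + ->]] /allpairsP[[a' b'] /= [+ + ->]] /=.
  rewrite !mem_iota => am bm am' bm' eq.
  have : nth x p (d + 2 * a) \in [set nth x p (d + 2 * a'); nth x p (d + 2 * b')].
    by rewrite -eq set21.
  have : nth x p (d + 2 * b) \in [set nth x p (d + 2 * a'); nth x p (d + 2 * b')].
    by rewrite -eq set22.
  (* Of the four ways to match the ends, the ranges a < m <= b leave only a = a' and b = b'. *)
  rewrite !inE => /orP[] /eqP/nthI h1 /orP[] /eqP/nthI h2.
  - by have := h1 ltac:(lia) ltac:(lia); lia.
  - by have := h2 ltac:(lia) ltac:(lia); lia.
  - have := h1 ltac:(lia) ltac:(lia); have := h2 ltac:(lia) ltac:(lia).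
    by move=> e1 e2; congr (_, _); lia.
  - by have := h2 ltac:(lia) ltac:(lia); lia.
move=> e /allpairsP[[a b] /= []]; rewrite !mem_iota => am bm ->.
rewrite mem_pairs cards2 nth_uniq //; try by apply: leq_trans dm; lia.
by have -> : (d + 2 * a != d + 2 * b)%N by lia.
Qed.

(** Union bound: if [E2] hits the chords of both halves of the path, two disjoint odd cycles joined
    by a path appear. *)
Lemma Ex_sprinkle (R : realFieldType) (V : finType) (q : R) (m : nat)
    (E1 : {set {set V}}) : 0 <= q <= 1 -> has_path (8 * m) E1 ->
  Ex q (pairs V) (fun E2 => `[< two_adaptable (E1 :|: E2) >]%:R) <=
    2 * (1 - q) ^+ (m * m).
Proof.
move=> q01 [x [s [sm us ps]]]; set p := x :: s in us.
have szp : size p = (size s).+1 by [].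
have <- : Ex q (pairs V) (fun E2 => (~~ has [in E2] (chords x p 0 m))%:R
    + (~~ has [in E2] (chords x p (4 * m) m))%:R) = 2 * (1 - q) ^+ (m * m).
  by rewrite ExD !Ex_no_chord // ?szp; [ring|lia|lia].
apply: le_Ex => // E2 _; case: asboolP => [ta|_]; last by rewrite addr_ge0.
have [|_] := boolP (has _ (chords x p 0 m)); last by rewrite lerDl.
case/chordsP => a [b [am bm ab]].
have [|_] := boolP (has _ (chords x p (4 * m) m)); last by rewrite lerDr.
case/chordsP => a' [b' [am' bm' ab']].
exfalso; apply: (two_chords_not_two_adaptable (E := E1 :|: E2) (x := x) (s := s)
  (i := (0 + 2 * a)%N) (j := (0 + 2 * b)%N) (k := (4 * m + 2 * a')%N)
  (l := (4 * m + 2 * b')%N)) => //.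
- by apply: sub_path ps => u v; rewrite /adj in_setU => ->.
- lia.
- by apply/andP; split; [lia|apply: leq_trans sm; lia].
- by rewrite !mul2n !add0n !odd_double.
- by rewrite !(oddD (4 * m)) !mul2n !odd_double.
- by move: ab; rewrite /adj in_setU => ->; rewrite orbT.
- by move: ab'; rewrite /adj in_setU => ->; rewrite orbT.
Qed.

(** * The random graph G(n,p) *)

Lemma adaptable_chromatic_number_le2 (V : finType) (G : sgraph V) :
  (adaptable_chromatic_number G <= 2)%N = `[< two_adaptable (edges G) >].
Proof.
rewrite /adaptable_chromatic_number; case: ex_minnP => k /andP[k0 kG] kmin.
apply/idP/asboolP => [k2|ta].
  case: k k0 kG k2 {kmin} => [//|[|[|//]]] _ kG _ c.
    (* With a single colour any edge would be violated, so there are no edges. *)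
    exists (fun=> true) => u v uv.
    move/forallP: kG => /(_ [ffun=> ord0]) /existsP[sigma].
    move=> /forallP /(_ (Sub [set u; v] uv)) /forallP /(_ u) /forallP /(_ v).
    by rewrite eqxx /= !ord1.
  pose o (b : bool) : 'I_2 := if b then ord_max else ord0.
  have oI : injective o by case=> [] [].
  move/forallP: kG => /(_ [ffun e => o (c (val e))]) /existsP[sigma sP].
  exists (fun u => sigma u == ord_max) => u v uv.
  move: sP => /forallP /(_ (Sub [set u; v] uv)) /forallP /(_ u) /forallP /(_ v).
  rewrite SubK eqxx /= !ffunE SubK.
  have so w : sigma w = o (sigma w == ord_max).
    by case: (sigma w) => -[|[|//]] ? //; apply: val_inj.
  by rewrite {1}(so u) {1}(so v) !(inj_eq oI).
apply: kmin; rewrite /=; apply/forallP => c.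
(* The edge colouring is extended to all vertex sets, with default value [false]. *)
pose c' (e : {set V}) : bool :=
  if insub e is Some e' then c (e' : edge_of G) == ord_max else false.
have [sigma sP] := ta c'; apply/existsP.
exists [ffun u => if sigma u then ord_max else ord0].
apply/forallP => e; apply/forallP => u; apply/forallP => v; apply/implyP => /eqP eE.
have := sP u v; rewrite /adj -eE => /(_ (valP e)).
rewrite /c' valK !ffunE.
case: (c e) => -[|[|//]] ?; case: (sigma u); case: (sigma v) => //=.
Qed.

(** The effective density: the Dirac mass at [false] is the Bernoulli law of parameter 0. *)
Definition edge_prob (R : realType) (p : R) : R := if 0 <= p <= 1 then p else 0.

Lemma fine_bernoulli_prob1 (R : realType) (p : R) (b : bool) :
  fine (bernoulli_prob p [set b]%classic) =
  if b then edge_prob p else 1 - edge_prob p.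
Proof.
rewrite /bernoulli_prob /edge_prob; case: ifP => _.
  by rewrite fsbig_set1 /bernoulli_pmf; case: b.
rewrite diracE; case: b => /=; first by rewrite memNset.
by rewrite mem_set //= subr0.
Qed.

Definition empty_graph (V : finType) : sgraph V.
Proof. by exists set0; apply/forallP => e; rewrite inE. Defined.

Lemma gnp_probE (R : realType) (n : nat) (p : R) (P : pred (sgraph 'I_n))
    (Q : {set {set 'I_n}} -> bool) : (forall G, P G = Q (edges G)) ->
  gnp_prob p P = Ex (edge_prob p) (pairs 'I_n) (fun E => (Q E)%:R).
Proof.
move=> PQ; rewrite Ex_sumE ?enum_uniq // (reindex_onto val (insubd (empty_graph _))); last first.
  move=> E /subsetP sE; rewrite insubdK //; apply/forallP => e; apply/implyP => /sE.
  by rewrite mem_pairs.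
rewrite /gnp_prob big_mkcond; apply: eq_big => G.
  rewrite valKd eqxx andbT; apply/esym/subsetP => e eG.
  by rewrite mem_pairs; move/forallP: (edges_card2 G) => /(_ e) /implyP; apply.
move=> _; rewrite PQ -[val G]/(edges G); case: (Q _); last by rewrite mulr0.
rewrite mulr1 /gnp_mass big_enum; apply: eq_bigr => e _.
by rewrite fine_bernoulli_prob1.
Qed.

(** * Limits and estimates at the two densities *)

Lemma cvg_to1 (R : realType) (u : nat -> R) (K : R) (n0 : nat) :
  (forall n, (n0 <= n)%N -> 1 - K / n%:R <= u n <= 1) -> (u @ \oo --> (1 : R))%classic.
Proof.
move=> uP; have lim1 : ((fun n => 1 - K / n%:R) @ \oo --> (1 - K * 0 : R))%classic.
  apply: cvgB; first exact: cvg_cst.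
  apply: cvgM; first exact: cvg_cst.
  (* [harmonic] is the sequence 1 / (n + 1), hence the shift. *)
  by rewrite -(cvg_shiftS (fun n => n%:R^-1 : R)); exact: cvg_harmonic.
rewrite mulr0 subr0 in lim1.
apply: (squeeze_cvgr (f := fun n => 1 - K / n%:R) (h := fun=> 1)) => //; last exact: cvg_cst.
by exists n0.
Qed.

(** Induction on (1 - q)^k (1 + k q) <= 1; it turns [k * q] of order n into a probability O(1/n). *)
Lemma exp1B_le (R : realFieldType) (q : R) (k : nat) : 0 <= q <= 1 ->
  (1 - q) ^+ k <= (1 + k%:R * q)^-1.
Proof.
move=> /andP[q0 q1]; have k0 : 0 < 1 + k%:R * q by rewrite ltr_pwDl // mulr_ge0.
rewrite -[leRHS]mul1r ler_pdivlMr // {k0}; elim: k => [|k IH]; first by rewrite mul0r addr0 mulr1.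
rewrite exprS -natr1; apply: le_trans IH; rewrite mulrAC mulrC.
rewrite ler_wpM2l ?exprn_ge0 ?subr_ge0 //.
have : 0 <= k%:R * q * q by rewrite !mulr_ge0.
have : 0 <= q * q by rewrite mulr_ge0.
lra.
Qed.

Lemma ex_nat_le (R : realType) (x : R) : 0 <= x -> exists k : nat, k%:R <= x < k%:R + 1.
Proof.
by move=> x0; exists (Num.truncn x); have := truncn_itv x0; rewrite -natr1.
Qed.

(* With a = (c - 1) / (2 c), after a n^2 / c queries the search has found about
   a n edges. Were all stacks short, about a n vertices would be finished, hence
   about a (1 - a) n^2 > a (1 - 2 a) n^2 = a n^2 / c pairs would be queried. *)
Lemma Ex_no_linear_path (R : realType) (c : R) : 1 < c ->
  exists d A : R, exists n0 : nat, 0 < d /\ forall n : nat, (n0 <= n)%N ->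
    exists m : nat, d * n%:R <= m%:R /\
      Ex (c / n%:R) (pairs 'I_n) (fun E => (~~ `[< has_path (8 * m) E >])%:R)
        <= A / n%:R.
Proof.
move=> c1; have c0 : 0 < c by lra.
pose a := (c - 1) / (2 * c).
have ca : c * a = (c - 1) / 2 by rewrite /a; field; rewrite gt_eqF.
have a0 : 0 < a by rewrite divr_gt0 ?mulr_gt0 ?subr_gt0.
have a2 : a < 1 / 2 by rewrite /a ltr_pdivrMr ?mulr_gt0 //; lra.
(* The slack [d] is small enough for (a - 4d) (1 - a + 2d) > a (1 - 2a), the strict inequality
   needed in the count of pairs. *)
pose d := a ^+ 2 / 16.
have d0 : 0 < d by rewrite divr_gt0 ?exprn_gt0.
have ad : a ^+ 2 = 16 * d by rewrite /d; field.
have da : 32 * d < a.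
  have : a ^+ 2 < a * (1 / 2) by rewrite expr2 ltr_pM2l.
  by rewrite ad; lra.
have ad4 : 0 <= a - 4 * d by lra.
have ad1 : 0 <= 1 - a + 2 * d by lra.
have dd : d * d <= d * 1 by rewrite ler_wpM2l ?(ltW d0) //; lra.
have ad0 := ltW (mulr_gt0 a0 d0).
pose mu := a * (1 - 2 * a).
have cmu : c * mu = a.
  by rewrite /mu /a; field; rewrite gt_eqF.
have mu0 : 0 <= mu by rewrite mulr_ge0 //; lra.
have [n0 /andP[_ n0P]] := ex_nat_le (ltW (divr_gt0 (mulr_gt0 (ltr0n _ 20) c0) d0) : 0 <= 20 * c / d).
exists (d / 16), (a / d ^+ 2), n0.+1; split; first by rewrite divr_gt0.
move=> n n0n; set N : R := n%:R.
have dN : 20 * c <= d * N.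
  rewrite [d * N]mulrC -ler_pdivrMr // (le_trans (ltW n0P)) //.
  by rewrite natr1 ler_nat.
have N0 : 0 < N by rewrite -(pmulr_rgt0 _ d0); lra.
have dN1 : 20 <= d * N by lra.
have N1 : c <= N.
  have : d * N <= 1 * N by rewrite ler_wpM2r //; lra.
  lra.
have dN8 : 0 <= d * N / 8 by lra.
(* Rounded down: 8 [m] is about d N, [s] about (a - 3d) N and [M] about mu N^2. As d N >= 20, each
   rounding error fits into the slack. *)
have [m /andP[m_le m_gt]] := ex_nat_le dN8.
have adN : 0 <= (a - 3 * d) * N by rewrite mulr_ge0 //; lra.
have [s /andP[s_le s_gt]] := ex_nat_le adN.
have [M /andP[M_le M_gt]] := ex_nat_le (mulr_ge0 mu0 (exprn_ge0 2 (ltW N0))).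
have q01 : 0 <= c / N <= 1 by rewrite (divr_ge0 (ltW c0) (ltW N0)) ler_pdivrMr ?mul1r.
have sumN : s%:R + 8 * m%:R <= (a - 2 * d) * N by lra.
have sN : (s + 8 * m <= n)%N.
  rewrite -(ler_nat R) natrD natrM (le_trans sumN) // -[leRHS]mul1r ler_wpM2r //; lra.
exists m; split; first by lra.
(* Of the a N expected positive answers, rounding and steps without a query cost at most 3c, and s +
   8m <= (a - 2d) N; there remain 2d N - 3c >= d N. *)
have lam : d * N <= c / N * (M%:R - (2 * s + 8 * m)%:R) - (s + 8 * m)%:R.
  have qM : a * N - c <= c / N * M%:R.
    have : c / N * (mu * N ^+ 2 - 1) <= c / N * M%:R.
      by rewrite ler_wpM2l //; [case/andP: q01|lra].
    have -> : c / N * (mu * N ^+ 2 - 1) = a * N - c / N.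
      by rewrite -cmu; field; rewrite gt_eqF.
    have : c / N <= c by rewrite ler_pdivrMr // ler_peMr ?(ltW c0) //; lra.
    lra.
  have qs : c / N * (2 * s + 8 * m)%:R <= 2 * c.
    rewrite mulrAC ler_pdivrMr // -mulrA [leRHS]mulrCA ler_wpM2l ?(ltW c0) //.
    by rewrite natrD !natrM; nra.
  rewrite mulrBr natrD natrM; lra.
have lam0 : 0 < d * N by lra.
apply: (le_trans (Ex_no_path (s0 := s) (u0 := 8 * m) (m := M) q01 _ _ _ _)).
- by rewrite card_ord (leq_trans (leq_addr _ _) sN).
- by rewrite muln_gt0 /= -(ltr_nat R); lra.
- rewrite card_ord -(ltr_nat R) natrM natrB // natrD natrM -/N.
  have s_ge : (a - 4 * d) * N <= s%:R by lra.
  have r_ge : (1 - a + 2 * d) * N <= N - (s%:R + 8 * m%:R) by lra.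
  apply: (le_lt_trans M_le); apply: (lt_le_trans _ (ler_pM _ _ s_ge r_ge)).
  + have -> : (a - 4 * d) * N * ((1 - a + 2 * d) * N) =
      (a - 4 * d) * (1 - a + 2 * d) * N ^+ 2 by ring.
    rewrite ltr_pM2r ?exprn_gt0 // /mu.
    move: ad dd ad0 d0; rewrite expr2; clear; lra.
  + exact: mulr_ge0 ad4 (ltW N0).
  + exact: mulr_ge0 ad1 (ltW N0).
- exact: lt_le_trans lam.
rewrite ler_pdivrMr; last by rewrite exprn_gt0 // (lt_le_trans lam0).
(* The variance bound is at most a N, and the deviation is at least d N. *)
apply: (@le_trans _ _ (a / d ^+ 2 / N * (d * N) ^+ 2)).
  have -> : a / d ^+ 2 / N * (d * N) ^+ 2 = c / N * (mu * N ^+ 2).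
    by rewrite -cmu; field; rewrite !gt_eqF.
  by rewrite ler_wpM2l //; case/andP: q01.
have aN0 : 0 <= a / d ^+ 2 / N.
  exact: divr_ge0 (divr_ge0 (ltW a0) (exprn_ge0 2 (ltW d0))) (ltW N0).
rewrite (ler_wpM2l aN0) // lerXn2r // nnegrE ?(ltW lam0) //.
exact: le_trans (ltW lam0) lam.
Qed.

(** Either the first round lacks a long path, with probability at most A / n, or the second round
    misses the chords of one half, with probability at most 2 (1 - q2)^(m^2). *)
Lemma Ex_two_adaptable_supercritical (R : realType) (eps : R) : 0 < eps ->
  exists K : R, exists n0 : nat, forall n : nat, (n0 <= n)%N ->
    0 <= (1 + eps) / n%:R <= 1 /\
    Ex ((1 + eps) / n%:R) (pairs 'I_n) (fun E => `[< two_adaptable E >]%:R)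
      <= K / n%:R.
Proof.
move=> e0; have [|d [A [n0 [d0 pathP]]]] := @Ex_no_linear_path R (1 + eps / 2); first by lra.
have e1 : 0 <= 1 + eps by lra.
have [n1 /andP[_ n1P]] := ex_nat_le e1.
exists (A + 4 / (d ^+ 2 * eps)), (maxn n0 n1.+1) => n; rewrite geq_max => /andP[n0n n1n].
set N : R := n%:R; have N1 : 1 + eps <= N.
  by rewrite (le_trans (ltW n1P)) // natr1 ler_nat.
have N0 : 0 < N by lra.
have q01 : 0 <= (1 + eps) / N <= 1.
  by rewrite (divr_ge0 e1 (ltW N0)) ler_pdivrMr ?mul1r.
split=> //.
have [m [dm noP]] := pathP _ n0n; rewrite -/N in dm noP.
set q1 := (1 + eps / 2) / N in noP.
have q1_0 : 0 <= q1 by rewrite divr_ge0 //; lra.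
have q1_1 : q1 < 1 by rewrite ltr_pdivrMr // mul1r; lra.
(* The solution of 1 - q = (1 - q1) (1 - q2) for q = (1 + eps) / N. *)
pose q2 := (eps / 2 / N) / (1 - q1).
have q12 : 1 - (1 + eps) / N = (1 - q1) * (1 - q2).
  rewrite mulrBr mulr1 mulrCA /q2 divff ?mulr1 /q1; last by rewrite gt_eqF // subr_gt0.
  by field; rewrite gt_eqF.
have q2_ge : eps / 2 / N <= q2.
  rewrite ler_pdivlMr ?subr_gt0 // ler_piMr //; last by lra.
  by rewrite !divr_ge0 // ltW.
have q2_0 : 0 <= q2 by apply: le_trans q2_ge; rewrite !divr_ge0 // ltW.
have q2_1 : q2 <= 1.
  rewrite -subr_ge0 -(pmulr_rge0 _ (_ : 0 < 1 - q1)) ?subr_gt0 // -q12 subr_ge0.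
  by case/andP: q01.
rewrite (Ex_union _ _ q12).
have q1_01 : 0 <= q1 <= 1 by rewrite q1_0 ltW.
have q2_01 : 0 <= q2 <= 1 by rewrite q2_0.
pose B := 2 * (1 - q2) ^+ (m * m).
have B0 : 0 <= B by rewrite mulr_ge0 // exprn_ge0 // subr_ge0.
apply: (@le_trans _ _ (A / N + B)).
  apply: le_trans (lerD noP (lexx B)); rewrite -(Ex_cst q1 (pairs 'I_n) B) -ExD.
  apply: le_Ex => // E1 _; case: asboolP => [E1P|_] /=.
    by rewrite add0r; apply: Ex_sprinkle.
  apply: (@le_trans _ _ 1); last by rewrite lerDl.
  rewrite -[leRHS](Ex_cst q2 (pairs 'I_n) 1); apply: le_Ex => // E2 _.
  by case: (asbool _); rewrite ?lexx ?ler01.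
rewrite mulrDl lerD2l.
(* m^2 q2 >= (d N)^2 eps / (2 N) is linear in N, so missing the chords has probability O(1/N). *)
have X0 : 0 < d ^+ 2 * eps * N / 2 by rewrite !mulr_gt0 ?exprn_gt0.
have le_X : d ^+ 2 * eps * N / 2 <= 1 + (m * m)%:R * q2.
  have m2 : (d * N) ^+ 2 <= (m * m)%:R.
    by rewrite natrM -expr2 lerXn2r // nnegrE // mulr_ge0 // ltW.
  have : (d * N) ^+ 2 * (eps / 2 / N) <= (m * m)%:R * q2.
    by apply: ler_pM; rewrite ?sqr_ge0 // !divr_ge0 // ltW.
  have -> : (d * N) ^+ 2 * (eps / 2 / N) = d ^+ 2 * eps * N / 2.
    by field; rewrite gt_eqF.
  lra.
apply: (@le_trans _ _ (2 * (d ^+ 2 * eps * N / 2)^-1)).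
  rewrite ler_wpM2l // (le_trans (exp1B_le _ q2_01)) //.
  by rewrite lef_pV2 ?posrE // (lt_le_trans X0).
by rewrite le_eqVlt; apply/orP; left; apply/eqP; field; rewrite !gt_eqF.
Qed.

Theorem theorem1p2 (R : realType) (eps : R) (heps : (0 < eps)%R) :
  gnp_whp (fun n : nat => (1 - eps) / n%:R)%R
    (fun (n : nat) (G : sgraph 'I_n) => (adaptable_chromatic_number G <= 2)%N)
  /\
  gnp_whp (fun n : nat => (1 + eps) / n%:R)%R
    (fun (n : nat) (G : sgraph 'I_n) => (2 < adaptable_chromatic_number G)%N).
Proof.
have Ex01 n (q : R) (Q : {set {set 'I_n}} -> bool) : 0 <= q <= 1 ->
    Ex q (pairs 'I_n) (fun E => (Q E)%:R) <= 1.
  move=> q01; rewrite -[leRHS](Ex_cst q (pairs 'I_n) 1); apply: le_Ex => // E _.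
  by case: (Q E); rewrite ?lexx ?ler01.
have ExN n (q : R) (Q : {set {set 'I_n}} -> bool) :
    Ex q (pairs 'I_n) (fun E => (~~ Q E)%:R) = 1 - Ex q (pairs 'I_n) (fun E => (Q E)%:R).
  apply/eqP; rewrite eq_sym subr_eq -ExD -[X in X == _](Ex_cst q (pairs 'I_n)).
  by apply/eqP/eq_Ex => E _; case: (Q E); rewrite /= ?addr0 ?add0r.
have q01 (p : R) : 0 <= edge_prob p <= 1.
  by rewrite /edge_prob; case: ifP => //; rewrite lexx ler01.
split.
  (* For eps > 1 and n > 0 the density is negative and the graph empty; the maximum keeps [c] in [0,
     1). *)
  pose c := Num.max 0 (1 - eps).
  have c01 : 0 <= c < 1 by rewrite /c le_max lexx /= gt_max ltr01; lra.
  apply: (@cvg_to1 _ _ (2 / (1 - c) ^+ 3) 0) => n _.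
  rewrite (gnp_probE _ (Q := fun E => `[< two_adaptable E >])); last first.
    by move=> G; apply: adaptable_chromatic_number_le2.
  rewrite Ex01 // andbT.
  have qc : 0 <= edge_prob ((1 - eps) / n%:R) <= c / #|'I_n|%:R.
    rewrite (andP (q01 _)).1 /= card_ord /edge_prob; case: ifP => _.
      by rewrite ler_wpM2r ?invr_ge0 // /c le_max lexx orbT.
    by rewrite mulr_ge0 ?invr_ge0 //; case/andP: c01.
  have := Ex_bicyclic_le c01 qc; rewrite card_ord => bic.
  apply: (@le_trans _ _ (1 - Ex (edge_prob ((1 - eps) / n%:R)) (pairs 'I_n)
      (fun E => `[< bicyclic E >]%:R))); first by rewrite lerD2l lerN2.
  rewrite -ExN; apply: le_Ex => // E El.
  case: (asboolP (bicyclic E)) => // nb; case: asboolP => // nta.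
  by case: nta; apply: two_adaptable_of_not_bicyclic => // e /El; rewrite mem_pairs => /eqP.
(* From [n0] on, (1 + eps) / n lies in [0, 1], so that [edge_prob] returns it unchanged. *)
have [K [n0 KP]] := Ex_two_adaptable_supercritical heps.
apply: (@cvg_to1 _ _ K n0) => n /KP[p01 taK].
rewrite (gnp_probE _ (Q := fun E => ~~ `[< two_adaptable E >])); last first.
  by move=> G; rewrite ltnNge adaptable_chromatic_number_le2.
by rewrite Ex01 // andbT ExN {1}/edge_prob p01 lerD2l lerN2.
Qed.
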